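(* Let $G$ be a connected graph of order $n\ge 2$ with maximum degree $\Delta(G)\le \frac{2}{3}(n-1)$. Then $\xi^d(G)\ge 2\xi^c(G)$. Moreover, equality holds if and only if $G$ is $2$-self-centered and $\frac{2}{3}(n-1)$-regular.
   Context: All graphs are finite, simple and connected. For a vertex $v$: $\deg(v)$ is its degree, $\varepsilon(v)=\max_u d(v,u)$ its eccentricity, $D(v)=\sum_u d(v,u)$ its total distance ($d$ the shortest-path distance). $\xi^c(G)=\sum_v\varepsilon(v)\deg(v)$, $\xi^d(G)=\sum_v\varepsilon(v)D(v)$. $G$ is $2$-self-centered if every vertex has eccentricity $2$; $k$-regular if every vertex has degree $k$. *)

(* Defs.v *)
From mathcomp Require Import all_boot all_order all_algebra.

Set Implicit Arguments.
Unset Strict Implicit.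
Unset Printing Implicit Defensive.

Record sgraph := SGraph {
  vertex :> finType;
  adj : rel vertex;
  adj_sym : symmetric adj;
  adj_irrefl : irreflexive adj
}.

Definition connected (G : sgraph) : Prop :=
  forall u v : G, connect (@adj G) u v.

Definition deg (G : sgraph) (v : G) : nat := #|[set u : G | adj v u]|.

Definition max_deg (G : sgraph) : nat := \max_(v : G) deg v.

Definition walk (G : sgraph) (u v : G) (k : nat) : bool :=
  [exists p : k.-tuple G, path (@adj G) u p && (last u p == v)].

(* The least length of a walk from u to v. A shortest walk has length less
   than #|G|, so it is enough to search below that bound; the junk value #|G|
   is returned when u and v lie in different components (see [distP]). *)
Definition dist (G : sgraph) (u v : G) : nat :=
  find (walk u v) (iota 0 #|G|).

Definition ecc (G : sgraph) (v : G) : nat := \max_(u : G) dist v u.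

Definition total_dist (G : sgraph) (v : G) : nat := \sum_(u : G) dist v u.

Definition ecc_connectivity_index (G : sgraph) : nat := \sum_(v : G) ecc v * deg v.

Definition ecc_distance_sum (G : sgraph) : nat := \sum_(v : G) ecc v * total_dist v.

Definition self_centered (r : nat) (G : sgraph) : Prop :=
  forall v : G, ecc v = r.

(* The degree is rational so that one may speak of 2/3(n-1)-regularity; when k
   is not a natural number, no nonempty graph is k-regular. *)
Definition regular (k : rat) (G : sgraph) : Prop :=
  forall v : G, ((deg v)%:R = k)%R.

Lemma walkP (G : sgraph) (u v : G) (k : nat) :
  reflect (exists p : seq G, [/\ size p = k, path (@adj G) u p & last u p = v])
          (walk u v k).
Proof.
apply: (iffP existsP) => [[p /andP[up /eqP pv]]|[p [sp up pv]]].
  by exists p; rewrite size_tuple.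
have sp' : size p == k by apply/eqP.
by exists (Tuple sp'); rewrite /= up pv eqxx.
Qed.

Lemma distP (G : sgraph) (u v : G) : connect (@adj G) u v ->
  walk u v (dist u v) /\ forall k, walk u v k -> dist u v <= k.
Proof.
case/connectP=> p up pv; case/shortenP: up pv => q uq /card_uniqP/= cq _ qv.
have sq : size q < #|G| by rewrite -cq max_card.
have wq : walk u v (size q) by apply/walkP; exists q.
have hasw : has (walk u v) (iota 0 #|G|).
  by apply/hasP; exists (size q); rewrite // mem_iota.
have dlt : dist u v < #|G| by rewrite /dist -[X in _ < X](size_iota 0) -has_find.
split=> [|k wk].
  by have := nth_find 0 hasw; rewrite nth_iota.
rewrite leqNgt; apply/negP=> kd.
have := before_find 0 kd; rewrite nth_iota ?add0n ?wk //.
exact: ltn_trans dlt.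
Qed.

(* Main.v *)
Require Import Defs.
From mathcomp Require Import all_boot all_order all_algebra.
From mathcomp Require Import zify lra.

(** At most [deg v] vertices are at distance 1 from [v] and all others are at
    distance at least 2, so [D(v) + deg(v) >= 2(n-1)], with equality if and
    only if [ecc(v) <= 2]. As [2(n-1) >= 3 deg(v)], this gives
    [D(v) >= 2 deg(v)]; multiplying by [ecc(v)] and summing over [v] yields the
    inequality. The degree bound excludes vertices adjacent to all others, so
    [ecc(v) >= 2], and equality holds exactly when both bounds are tight at
    every vertex. *)

Lemma walk0 {G : sgraph} (u v : G) : walk u v 0 = (u == v).
Proof.
apply/walkP/eqP => [[p [/size0nil -> _ /= ->]] //|->].
by exists [::].
Qed.

Lemma walk1 {G : sgraph} (u v : G) : walk u v 1 = adj u v.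
Proof.
apply/walkP/idP => [[[|x [|y p]] [//= _]]|uv].
  by rewrite andbT => ux <-.
by exists [:: v]; rewrite /= uv.
Qed.

Lemma distxx {G : sgraph} (v : G) : dist v v = 0.
Proof.
have [_ /(_ 0)] := distP (connect0 (@adj G) v).
by rewrite walk0 eqxx leqn0 => /(_ isT) /eqP.
Qed.

(** A neighbour of [v] contributes 1 + 1, any other [u] at least 2 + 0. The factor [u != v] makes
    both sides vanish at [u = v], so the bound can be summed over all of [G]. *)
Lemma dist_adj_leqif {G : sgraph} (v u : G) : connected G ->
  2 * (u != v) <= dist v u + adj v u ?= iff (dist v u <= 2).
Proof.
move=> Gconn; have [->|neq_uv] := eqVneq u v.
  by rewrite distxx adj_irrefl; split.
have [wd min_d] := distP (Gconn v u).
have d_gt0 : 0 < dist v u.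
  rewrite lt0n; apply: contraNneq neq_uv => d0.
  by move: wd; rewrite d0 walk0 eq_sym.
have [vu|nvu] := boolP (adj v u).
  have := min_d 1; rewrite walk1 vu => /(_ isT) d_le1.
  by have -> : dist v u = 1 by lia.
have d_neq1 : dist v u != 1.
  by apply: contraNneq nvu => d1; move: wd; rewrite d1 walk1.
by split; lia.
Qed.

Lemma sum_neq {T : finType} (v : T) : \sum_(u : T) (u != v) = #|T|.-1.
Proof.
rewrite -(cardC1 v) -sum1_card [RHS]big_mkcond; apply: eq_bigr => u _.
by rewrite inE; case: eqP.
Qed.

Lemma deg_sum {G : sgraph} (v : G) : deg v = \sum_(u : G) adj v u.
Proof.
rewrite /deg -sum1_card big_mkcond; apply: eq_bigr => u _.
by rewrite inE; case: (adj v u).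
Qed.

Lemma total_dist_deg_leqif {G : sgraph} (v : G) : connected G ->
  2 * #|G|.-1 <= total_dist v + deg v ?= iff (ecc v <= 2).
Proof.
move=> Gconn; rewrite -(sum_neq v) big_distrr deg_sum -big_split /=.
(* A sum of bounds is tight iff every term is, hence this pointwise form. *)
have -> : (ecc v <= 2) = [forall u : G, dist v u <= 2].
  apply/bigmax_leqP/forallP => [h u|h u _]; exact: h.
by apply: leqif_sum => u _; apply: dist_adj_leqif.
Qed.

Lemma total_dist_le {G : sgraph} (v : G) : total_dist v <= ecc v * #|G|.-1.
Proof.
rewrite -(sum_neq v) big_distrr; apply: leq_sum => u _ /=.
have [->|_] := eqVneq u v; first by rewrite distxx.
by rewrite muln1 (leq_bigmax (F := dist v)).
Qed.

(** If [ecc v <= 1], then [total_dist v <= #|G|.-1], and the lower bound on [total_dist v + deg v]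
    forces [deg v >= #|G|.-1]. *)
Lemma ecc_ge2 {G : sgraph} (v : G) : connected G -> deg v < #|G|.-1 ->
  2 <= ecc v.
Proof.
move=> Gconn deg_lt; rewrite ltnNge; apply/negP => e_le1.
have [lb _] := total_dist_deg_leqif v Gconn.
have ub := total_dist_le v.
have : ecc v * #|G|.-1 <= 1 * #|G|.-1 by rewrite leq_mul2r e_le1 orbT.
lia.
Qed.

Lemma ecc_deg_leqif {G : sgraph} (v : G) : connected G -> 2 <= #|G| ->
  3 * deg v <= 2 * #|G|.-1 ->
  2 * (ecc v * deg v) <= ecc v * total_dist v
    ?= iff (ecc v == 2) && (3 * deg v == 2 * #|G|.-1).
Proof.
move=> Gconn Gn deg_le; have e_ge2 : 2 <= ecc v by apply: ecc_ge2 => //; lia.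
have [lb eq_lb] := total_dist_deg_leqif v Gconn.
rewrite mulnCA; split; first by rewrite leq_mul2l; lia.
(* As [ecc v > 0], it cancels. If [total_dist v = 2 * deg v], then
   [total_dist v + deg v = 3 * deg v] has [2 * #|G|.-1] as both lower and upper bound, so both
   bounds are tight. *)
by rewrite eqn_mul2l; lia.
Qed.

Theorem theorem4p2 (G : sgraph) (Gconn : connected G) (Gn : 2 <= #|G|)
    (GD : ((max_deg G)%:R <= 2 / 3 * (#|G|%:R - 1) :> rat)%R) :
  ecc_distance_sum G >= 2 * ecc_connectivity_index G /\
  (ecc_distance_sum G = 2 * ecc_connectivity_index G <->
    self_centered 2 G /\ regular (2 / 3 * (#|G|%:R - 1))%R G).
Proof.
have cardE : (#|G|%:R - 1 = #|G|.-1%:R :> rat)%R.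
  by rewrite -[in LHS](prednK (ltnW Gn)) -GRing.natr1 GRing.addrK.
have deg_le (v : G) : 3 * deg v <= 2 * #|G|.-1.
  have dv : deg v <= max_deg G by apply: (leq_bigmax (F := @deg G)).
  suff : 3 * max_deg G <= 2 * #|G|.-1 by lia.
  by move: GD; rewrite cardE -(Num.Theory.ler_nat rat) !GRing.natrM; lra.
(* Clearing denominators turns regularity into the equality case of [ecc_deg_leqif]. *)
have regE (v : G) :
    ((deg v)%:R = 2 / 3 * (#|G|%:R - 1) :> rat)%R <-> 3 * deg v = 2 * #|G|.-1.
  rewrite cardE; split=> [dv|/(congr1 (fun k => k%:R : rat)%R)].
    by apply/eqP; rewrite -(Num.Theory.eqr_nat rat) !GRing.natrM; apply/eqP; lra.
  by rewrite !GRing.natrM; lra.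
have [le_sum eq_sum] : 2 * ecc_connectivity_index G <= ecc_distance_sum G
    ?= iff [forall v : G, (ecc v == 2) && (3 * deg v == 2 * #|G|.-1)].
  rewrite /ecc_connectivity_index big_distrr /=.
  by apply: leqif_sum => v _; apply: ecc_deg_leqif.
split=> //; split=> [/esym/eqP|[sc reg]].
  rewrite eq_sum => /forallP h.
  by split=> v; have /andP[/eqP ev /eqP dv] := h v; [|apply/regE].
apply/esym/eqP; rewrite eq_sum; apply/forallP => v.
by rewrite sc eqxx /=; apply/eqP/regE.
Qed.
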